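(* Let $\mathbb K$ be a field, let $A$ be a commutative associative $\mathbb K$-algebra with identity which is an integral domain, let $R$ be the quotient field of $A$, and let $W(A)=R\,\mathrm{Der}\,A$. Let $L$ be a nilpotent $\mathbb K$-subalgebra of rank $k$ over $R$ of the Lie algebra $W(A)$. Then the derived length of $L$ is at most $k$.
   Context: $\mathrm{Der}\,A$ denotes the Lie algebra of all $\mathbb K$-derivations of $A$; it is an $A$-module via $(aD)(x)=a\cdot D(x)$. Every derivation of $A$ extends uniquely to a derivation of the quotient field $R$, so $W(A)=R\,\mathrm{Der}\,A$ (the set of all $R$-linear combinations of such extended derivations) is a $\mathbb K$-Lie subalgebra of $\mathrm{Der}\,R$ and a vector space over $R$ (it is not in general a Lie algebra over $R$). Subalgebras of $W(A)$ are $\mathbb K$-subalgebras. For a subalgebra $L\subseteq W(A)$, $RL$ is the $R$-span of $L$ and the rank of $L$ over $R$ is $\mathrm{rk}_R L=\dim_R RL$. *)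

(* Defs.v *)
From HB Require Import structures.
From mathcomp Require Import all_boot all_order all_algebra generic_quotient.
From mathcomp Require Import ring.
From mathcomp Require Import boolp classical_sets functions.

Set Implicit Arguments.
Unset Strict Implicit.
Unset Printing Implicit Defensive.

Import GRing.Theory.
Local Open Scope classical_set_scope.
Local Open Scope ring_scope.

Notation "x %:F" := (@FracField.tofrac _ x) : ring_scope.

#[short(type="idomAlgType")]
HB.structure Definition IdomainAlgebra (K : nzRingType) :=
  {A of GRing.IntegralDomain A & GRing.ComUnitAlgebra K A}.

(* The field of fractions of a K-algebra A, as a K-algebra. *)
Section FractionAlgebra.
Variables (K : fieldType) (A : idomAlgType K).

Definition frac_scale (c : K) (x : {fraction A}) : {fraction A} :=
  (c%:A : A)%:F * x.

Fact frac_scaleA a b x : frac_scale a (frac_scale b x) = frac_scale (a * b) x.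
Proof.
by rewrite /frac_scale mulrA -tofracM -scalerAl mul1r scalerA.
Qed.

Fact frac_scale1 : left_id 1 frac_scale.
Proof. by move=> x; rewrite /frac_scale scale1r tofrac1 mul1r. Qed.

Fact frac_scaleDr : right_distributive frac_scale +%R.
Proof. by move=> a x y; rewrite /frac_scale mulrDr. Qed.

Fact frac_scaleDl v : {morph frac_scale^~ v : a b / a + b}.
Proof. by move=> a b; rewrite /frac_scale scalerDl tofracD mulrDl. Qed.

HB.instance Definition _ := GRing.Zmodule_isLmodule.Build K {fraction A}
  frac_scaleA frac_scale1 frac_scaleDr frac_scaleDl.

Fact frac_scaleAl (c : K) (x y : {fraction A}) : c *: (x * y) = (c *: x) * y.
Proof. exact: mulrA. Qed.

HB.instance Definition _ :=
  GRing.Lmodule_isLalgebra.Build K {fraction A} frac_scaleAl.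

Fact frac_scaleAr (c : K) (x y : {fraction A}) : c *: (x * y) = x * (c *: y).
Proof. exact: mulrCA. Qed.

HB.instance Definition _ :=
  GRing.Lalgebra_isAlgebra.Build K {fraction A} frac_scaleAr.

End FractionAlgebra.

Section LinearAlgebra.
Variables (F : fieldType) (V : lmodType F).

Definition lin_span (S : set V) : set V :=
  [set v | exists (n : nat) (c : 'I_n -> F) (s : 'I_n -> V),
     (forall i, S (s i)) /\ v = \sum_(i < n) c i *: s i].

Definition lin_indep (k : nat) (e : 'I_k -> V) : Prop :=
  forall c : 'I_k -> F, \sum_(i < k) c i *: e i = 0 -> forall i, c i = 0.

Definition has_dim (U : set V) (k : nat) : Prop :=
  exists e : 'I_k -> V, lin_indep e /\ lin_span (range e) = U.

End LinearAlgebra.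

(* Lie algebras of K-linear operators on a commutative K-algebra B; operators
   are plain functions B -> B, with the pointwise K-module structure. *)
Section Derivations.
Variables (K : fieldType) (B : comAlgType K).
Implicit Types (D E : B -> B) (L M N : set (B -> B)).

Definition derivation D : Prop :=
  (forall (c : K) (x y : B), D (c *: x + y) = c *: D x + D y) /\
  (forall x y : B, D (x * y) = D x * y + x * D y).

Definition lie_bracket D E : B -> B := fun x => D (E x) - E (D x).

Definition lie_subalgebra L : Prop :=
  [/\ L 0,
      forall (c : K) D E, L D -> L E -> L (c *: D + E) &
      forall D E, L D -> L E -> L (lie_bracket D E)].

Definition lie_product M N : set (B -> B) :=
  @lin_span K (B -> B) [set lie_bracket D E | D in M & E in N].

Fixpoint lower_central L (n : nat) : set (B -> B) :=
  if n is m.+1 then lie_product L (lower_central L m) else L.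

Definition lie_nilpotent L : Prop :=
  exists n : nat, lower_central L n = [set 0].

Fixpoint derived_series L (n : nat) : set (B -> B) :=
  if n is m.+1 then lie_product (derived_series L m) (derived_series L m)
  else L.

Definition has_derived_length L (s : nat) : Prop :=
  derived_series L s = [set 0] /\
  forall t : nat, derived_series L t = [set 0] -> (s <= t)%N.

End Derivations.

Section FieldIdentities.
Variable F : fieldType.
Implicit Types a b u v c n m d e : F.

Lemma der_frac_id1 u' v v' a' b b' : b != 0 -> b' != 0 ->
  ((u' * b + a' * v - a' * b / b' * v') / b' * b - a' * b / b' * v) / b ^+ 2
  = (u' * b' - a' * v') / b' ^+ 2.
Proof. by move=> b0 b'0; field; rewrite b0 b'0. Qed.

Lemma der_frac_id2 u v n d : d != 0 -> (u * d - n * v) / d ^+ 2 * d = u - n / d * v.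
Proof. by move=> d0; field. Qed.

Lemma der_frac_id3 c n d m e : d != 0 -> e != 0 ->
  c * (n / d) + m / e = (c * n * e + m * d) / (d * e).
Proof. by move=> d0 e0; field; rewrite d0 e0. Qed.

Lemma der_frac_id4 c n d m e n' d' m' e' : d != 0 -> e != 0 ->
  ((c * n' * e + c * n * e' + (m' * d + m * d')) * (d * e) -
   (c * n * e + m * d) * (d' * e + d * e')) / (d * e) ^+ 2 =
  c * ((n' * d - n * d') / d ^+ 2) + (m' * e - m * e') / e ^+ 2.
Proof. by move=> d0 e0; field; rewrite d0 e0. Qed.

Lemma der_frac_id5 n d m e n' d' m' e' : d != 0 -> e != 0 ->
  ((n' * m + n * m') * (d * e) - n * m * (d' * e + d * e')) / (d * e) ^+ 2 =
  (n' * d - n * d') / d ^+ 2 * (m / e) + n / d * ((m' * e - m * e') / e ^+ 2).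
Proof. by move=> d0 e0; field; rewrite d0 e0. Qed.
End FieldIdentities.

Section WA.
Variables (K : fieldType) (A : idomAlgType K).
Local Notation R := {fraction A}.

Definition extends_der (D : A -> A) (E : R -> R) : Prop :=
  derivation (K := K) E /\ forall a : A, E a%:F = (D a)%:F.

Lemma frac_num_den (x : R) : exists n d : A, d != 0 /\ x = n%:F / d%:F.
Proof.
elim/quotW: x => -[[n d] /= d0]; exists n, d; split=> //.
have dF : d%:F != 0 :> R by rewrite tofrac_eq0.
apply: (mulIf dF); rewrite mulfVK //.
unlock FracField.tofrac; rewrite -[_ * _]/(FracField.mul _ _) !piE.
apply/eqmodP; rewrite /= FracField.equivfE /FracField.mulf.
by rewrite !numden_Ratio ?mulr1 ?mul1r ?oner_neq0 // mulrC.
Qed.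

Lemma extends_der_exists_unique (D : A -> A) :
  derivation (K := K) D -> exists! E : R -> R, extends_der D E.
Proof.
move=> [Dlin DM].
have D0 : D 0 = 0.
  by have := Dlin (-1) 0 0; rewrite scaler0 addr0 scaleN1r addNr.
have DD x y : D (x + y) = D x + D y.
  by have := Dlin 1 x y; rewrite !scale1r.
have DZ c x : D (c *: x) = c *: D x by have := Dlin c x 0; rewrite D0 !addr0.
pose nd (x : R) : A * A := let n := xget 0 [set n | exists d : A, d != 0 /\ x = n%:F / d%:F] in
  (n, xget 1 [set d | d != 0 /\ x = n%:F / d%:F]).
have ndP x : (nd x).2 != 0 /\ x = (nd x).1%:F / (nd x).2%:F.
  have [n [d H]] := frac_num_den x.
  have Hn : exists d : A, d != 0 /\ x = (nd x).1%:F / d%:F.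
    by rewrite /nd /=; case: xgetP => [y _ //|/(_ n)]; case; exists d.
  case: Hn => e He; rewrite {2 3}/nd /=; case: xgetP => [y _ //|/(_ e) []].
  exact: He.
pose q n d : R := ((D n)%:F * d%:F - n%:F * (D d)%:F) / d%:F ^+ 2.
have F0 (d : A) : d != 0 -> d%:F != 0 :> R by rewrite tofrac_eq0.
have qwd n d n' d' : d != 0 -> d' != 0 -> n%:F / d%:F = n'%:F / d'%:F :> R ->
    q n d = q n' d'.
  move=> d0 d'0 /eqP; rewrite GRing.eqr_div ?F0 // -!tofracM tofrac_eq => /eqP E.
  have := congr1 D E; rewrite !DM => E'.
  have {}E := congr1 (@FracField.tofrac A) E; have {}E' := congr1 (@FracField.tofrac A) E'.
  move: E E'; rewrite !tofracD !tofracM /q.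
  move: (F0 _ d0) (F0 _ d'0) => {}d0 {}d'0.
  set a := n%:F; set a' := n'%:F; set b := d%:F in d0 *; set b' := d'%:F in d'0 *.
  move: (D n)%:F (D n')%:F (D d)%:F (D d')%:F => u u' v v' E E'.
  have -> : a = a' * b / b' by rewrite -E mulfK.
  have -> : u = (u' * b + a' * v - a' * b / b' * v') / b'.
    have -> : a' * b / b' = a by rewrite -E mulfK.
    by rewrite -E' addrK mulfK.
  exact: der_frac_id1.
pose E x := q (nd x).1 (nd x).2.
have EE n d : d != 0 -> E (n%:F / d%:F) = q n d.
  by move=> d0; have [h1 h2] := ndP (n%:F / d%:F); apply: qwd.
have D1 : D 1 = 0.
  have := DM 1 1; rewrite !mulr1 mul1r => /eqP; rewrite -subr_eq0 opprD addNKr oppr_eq0.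
  by move/eqP.
have EF a : E a%:F = (D a)%:F.
  have -> : a%:F = a%:F / (1 : A)%:F :> R by rewrite tofrac1 divr1.
  rewrite EE ?oner_neq0 // /q D1 tofrac1 tofrac0 mulr0 subr0.
  by rewrite expr1n divr1 mulr1.
exists E; split; last first.
  move=> E' [[_ E'M] E'F]; apply/funext => x.
  have [n [d [d0 ->]]] := frac_num_den x.
  have := E'M (n%:F / d%:F) d%:F; rewrite mulfVK ?F0 // !E'F => h.
  apply: (mulIf (F0 _ d0)); rewrite EE //.
  move: (F0 _ d0) h => {}d0; set y := E' _; rewrite /q => h.
  have -> : y * d%:F = (D n)%:F - n%:F / d%:F * (D d)%:F by rewrite h addrK.
  by rewrite der_frac_id2.
split=> //; split.
- move=> c x y.
  have [n [d [d0 ->]]] := frac_num_den x; have [m [e [e0 ->]]] := frac_num_den y.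
  have -> : c *: (n%:F / d%:F) + m%:F / e%:F =
      ((c *: n) * e + m * d)%:F / (d * e)%:F :> R.
    rewrite -[c *: (_ / _)]/((c%:A : A)%:F * _) -[c *: n]mulr_algl.
    rewrite !(tofracM, tofracD).
    by apply: der_frac_id3; apply: F0.
  rewrite !EE ?mulf_neq0 // -[c *: q _ _]/((c%:A : A)%:F * _) /q.
  rewrite !(DM, DD, DZ) -[c *: n]mulr_algl -[c *: D n]mulr_algl.
  rewrite !(tofracM, tofracD).
  by apply: der_frac_id4; apply: F0.
- move=> x y.
  have [n [d [d0 ->]]] := frac_num_den x; have [m [e [e0 ->]]] := frac_num_den y.
  have -> : (n%:F / d%:F) * (m%:F / e%:F) = (n * m)%:F / (d * e)%:F :> R.
    by rewrite !tofracM mulf_div.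
  rewrite !EE ?mulf_neq0 // /q !DM !(tofracM, tofracD).
  by apply: der_frac_id5; apply: F0.
Qed.

(* R^o makes R act on operators R -> R by (r *: D) x = r * D x; without it,
   the scalars would be those of K. *)
Definition Rspan (S : set (R -> R)) : set (R -> R) :=
  @lin_span R (R -> R^o) S.

Definition W : set (R -> R) :=
  Rspan [set E | exists2 D : A -> A,
                   derivation (K := K) D & extends_der D E].

Definition has_rank (L : set (R -> R)) (k : nat) : Prop :=
  @has_dim R (R -> R^o) (Rspan L) k.

End WA.

Arguments W K A : clear implicits.

(* Main.v *)
Require Import Defs.
From mathcomp Require Import all_boot all_order all_algebra.
From mathcomp Require Import boolp classical_sets functions.
From mathcomp Require Import ring.
Local Open Scope classical_set_scope.
Local Open Scope ring_scope.

(** Write [V] for an [R]-subspace of operators spanned by elements of [L] and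
    stable under bracketing with [L]; start from [V = 0].  As long as [L] is
    not contained in [V], nilpotency yields [z] in [L], outside [V], that is
    central modulo [V], i.e. [[L, z] <= V]: take [z] in the last term of the
    lower central series not contained in [V] ([exists_central_mod]).  Then
    [V' = V + R z] is again spanned by elements of [L] and stable
    ([ad_stable_add_central]).

    The key point is that [(L :&: V') / (L :&: V)] is abelian
    ([bracket_add_central]).  Let [x] and [y = a z + v] be in [L :&: V'].
    Modulo [V], Leibniz' rule gives [[x, y] = x(a) z].  Now every [D] in [L]
    that lies in [V], and also [D = z], satisfies [[D, y] = 0] modulo [V], hence
    [D(a) = 0].  But [D |-> D(a)] is [R]-linear and those [D] span [V'] over
    [R], so [x(a) = 0].

    Each such enlargement uses up one dimension of [R L / V], by the Steinitz
    exchange lemma ([lin_span_exchange]), so after at most [k] steps [L] is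
    contained in [V].  Going back down this flag, each derivation of [L] loses
    one step, and the [k]-th term of the derived series lies in [V = 0]
    ([derived_series_sub_span]). *)

Set Implicit Arguments.
Unset Strict Implicit.
Unset Printing Implicit Defensive.
Import GRing.Theory.

(** * Linear spans *)

Section LinearSpan.
Variables (F : fieldType) (V : lmodType F).
Implicit Types (S T U : set V) (u v z : V).

Definition subspace U : Prop :=
  U 0 /\ forall (a : F) u v, U u -> U v -> U (a *: u + v).

Lemma subspaceD U u v : subspace U -> U u -> U v -> U (u + v).
Proof. by move=> [_ h] Uu Uv; rewrite -[u]scale1r; apply: h. Qed.

Lemma subspaceZ U (a : F) u : subspace U -> U u -> U (a *: u).
Proof. by move=> [U0 h] Uu; rewrite -[_ *: _]addr0; apply: h. Qed.

Lemma subspaceN U u : subspace U -> U u -> U (- u).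
Proof. by move=> sU Uu; rewrite -scaleN1r; apply: subspaceZ. Qed.

Lemma subspaceB U u v : subspace U -> U u -> U v -> U (u - v).
Proof. by move=> sU Uu Uv; apply: subspaceD => //; apply: subspaceN. Qed.

Lemma lin_span_subspace S : subspace (lin_span S).
Proof.
split.
  exists 0%N, (fun=> 0), (fun=> 0); split; first by case.
  by rewrite big_ord0.
move=> a _ _ [n [c [s [Ss ->]]]] [m [d [t [St ->]]]].
exists (n + m)%N,
  (fun i => match fintype.split i with inl j => a * c j | inr j => d j end),
  (fun i => match fintype.split i with inl j => s j | inr j => t j end).
split=> [i|]; first by case: (fintype.split i).
rewrite big_split_ord /= scaler_sumr; congr (_ + _); apply: eq_bigr => i _.
  by rewrite (unsplitK (inl _ i)) scalerA.
by rewrite (unsplitK (inr _ i)).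
Qed.

Lemma sub_lin_span S : S `<=` lin_span S.
Proof.
move=> u Su; exists 1%N, (fun=> 1), (fun=> u); split=> //.
by rewrite big_ord1 scale1r.
Qed.

Lemma lin_span_min S U : subspace U -> S `<=` U -> lin_span S `<=` U.
Proof.
move=> sU SU _ [n [c [s [Ss ->]]]].
elim/big_ind: _ => [|u v|i _]; first by case: sU.
  exact: subspaceD.
by apply: subspaceZ => //; apply: SU.
Qed.

Lemma lin_spanS S T : S `<=` lin_span T -> lin_span S `<=` lin_span T.
Proof. by apply: lin_span_min; apply: lin_span_subspace. Qed.

Lemma lin_span_set0 : lin_span set0 = [set 0 : V].
Proof.
apply/seteqP; split=> [|_ ->]; last by case: (lin_span_subspace set0).
by apply: lin_span_min => //; split=> // a _ _ -> ->; rewrite scaler0 addr0.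
Qed.

Lemma lin_span_setU1 S z v :
  lin_span (z |` S) v -> exists a, exists2 u, lin_span S u & v = a *: z + u.
Proof.
have [S0 SD] := lin_span_subspace S.
move: v; apply: lin_span_min => [|v [->|Sv]].
- split; first by exists 0, 0; rewrite // scale0r addr0.
  move=> c _ _ [a [u Su ->]] [b [w Sw ->]].
  exists (c * a + b), (c *: u + w); first exact: SD.
  by rewrite scalerDr scalerA scalerDl addrACA.
- by exists 1, 0; rewrite // scale1r addr0.
- by exists 0, v; [exact: sub_lin_span | rewrite scale0r add0r].
Qed.

(** Steinitz exchange modulo the span of [S]: written on [S] and [e], [z] has a
    nonzero coefficient at some entry of [e], which can then be solved for and
    dropped.  The length of [e] thus bounds the codimension still to go. *)
Lemma lin_span_exchange S (e : seq V) z :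
  lin_span (S `|` [set` e]) z -> ~ lin_span S z ->
  exists2 e' : seq V, size e = (size e').+1 &
    lin_span (S `|` [set` e]) `<=` lin_span ((z |` S) `|` [set` e']).
Proof.
move=> + nSz; elim: e => [|x e IHe].
  rewrite (_ : S `|` _ = S) //.
  by apply/seteqP; split=> u //=; [case | left].
have eqU : S `|` [set` x :: e] = x |` (S `|` [set` e]).
  apply/seteqP; split=> u /=; rewrite inE.
    by case=> [?|/orP[/eqP|]]; [right; left | left | right; right].
  by case=> [->|[?|->]]; [right; rewrite eqxx | left | right; rewrite orbT].
rewrite eqU => /lin_span_setU1[a [w Sw defz]].
have [a0|a0] := eqVneq a 0.
  have Sz : lin_span (S `|` [set` e]) z by rewrite defz a0 scale0r add0r.
  have [e' sz_e' sub_e'] := IHe Sz; exists (x :: e'); first by rewrite /= sz_e'.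
  apply: lin_spanS => u [->|Su].
    by apply: sub_lin_span; right; rewrite /= inE eqxx.
  have := sub_e' u (sub_lin_span Su); move: u {Su}; apply: lin_spanS => u Tu.
  apply: sub_lin_span; case: Tu => [|e'u]; first by left.
  by right; rewrite /= inE e'u orbT.
(* here the entry to drop is the head [x] *)
exists e => //.
have sST : lin_span (S `|` [set` e]) `<=` lin_span ((z |` S) `|` [set` e]).
  apply: lin_spanS => u Su; apply: sub_lin_span.
  by case: Su => [Su|eu]; [left; right | right].
apply: lin_spanS => u [->|Su]; last by apply/sST/sub_lin_span.
have -> : x = a^-1 *: (z - w) by rewrite defz addrK scalerA mulVf ?scale1r.
apply: subspaceZ; first exact: lin_span_subspace.
apply: subspaceB; [exact: lin_span_subspace | | exact: sST].
by apply: sub_lin_span; left; left.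
Qed.

End LinearSpan.

(** * Operators on the field of fractions *)

Section NilpotentDerivations.
Variables (K : fieldType) (A : idomAlgType K).
Local Notation R := {fraction A}.
Local Notation opR := (R -> R^o).
Local Notation Rsubspace := (@subspace R opR).
Local Notation bracket := (@lie_bracket K R).
Implicit Types (L S U : set (R -> R)) (D E : R -> R).

(** The derived series is built from [K]-spans, whereas the flag consists of
    [R]-subspaces; [K] acts on operators through its image in [R]. *)
Lemma Rsubspace_lin_span S U :
  Rsubspace U -> S `<=` U -> @lin_span K (R -> R) S `<=` U.
Proof.
move=> sU SU; apply: lin_span_min => //; split; first by case: sU.
move=> c u v Uu Uv; exact: (proj2 sU (c%:A : A)%:F).
Qed.

Lemma derivation_subspace : Rsubspace [set D | derivation (K := K) (D : R -> R)].
Proof.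
split.
  split=> [c x y|x y].
    by rewrite -[RHS]/(c *: (0 : R) + 0) scaler0 addr0.
  by rewrite -[RHS]/(0 * y + x * 0) mul0r mulr0 addr0.
move=> a D E [Dlin DM] [Elin EM].
have ev x : (a *: (D : opR) + (E : opR)) x = a * D x + E x :> R by [].
split=> [c x y|x y]; rewrite !ev.
  by rewrite Dlin Elin mulrDr scalerDr -scalerAr addrACA.
by rewrite DM EM; ring.
Qed.

Lemma W_derivation : W K A `<=` [set D | derivation (K := K) D].
Proof.
by apply: lin_span_min derivation_subspace _ => E [D _ []].
Qed.

(** The failure of the bracket to be [R]-bilinear, on which everything rests.
    As [u] and [v] range over arbitrary operators, elements of [R]-spans can be
    substituted freely. *)
Lemma bracketZD D (a : R) (u v : opR) : derivation (K := K) D ->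
  bracket D (a *: u + v) =
    (D a : R) *: u + (a *: (bracket D u : opR) + bracket D v) :> opR.
Proof.
move=> [Dlin DM]; apply/funext => x.
have DD p q : D (p + q) = D p + D q by have := Dlin 1 p q; rewrite !scale1r.
rewrite -[LHS]/(D (a * u x + v x) - (a * u (D x) + v (D x)) : R).
rewrite -[RHS]/(D a * u x + (a * (D (u x) - u (D x)) + (D (v x) - v (D x))) : R).
by rewrite DD DM; ring.
Qed.

Lemma bracket_anticomm D E : bracket D E = - (bracket E D).
Proof. by apply/funext => x; rewrite -[RHS]/(- (_ - _)) opprB. Qed.

Definition ad_stable L S : Prop :=
  forall D, L D -> forall E, Rspan S E -> Rspan S (bracket D E).

Definition central_mod L U E : Prop := forall D, L D -> U (bracket D E).

(** In [bracket D (a z + u)] the Leibniz term is a multiple of [z], and the two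
    others lie in the span of [S]. *)
Lemma ad_stable_add_central L S z :
    L `<=` [set D | derivation (K := K) D] ->
    ad_stable L S -> central_mod L (Rspan S) z ->
  ad_stable L (z |` S).
Proof.
move=> derL stS cz D LD _ /lin_span_setU1[a [u Su ->]].
have sT := @lin_span_subspace R opR (z |` S).
have sub : Rspan S `<=` Rspan (z |` S).
  by apply: (@lin_spanS R opR) => E SE; apply: sub_lin_span; right.
rewrite bracketZD; last exact: derL.
apply: (proj2 sT); first by apply: sub_lin_span; left.
by apply: (proj2 sT); apply: sub; [apply: cz | apply: stS].
Qed.

(** Abelianity of each step of the flag.  With [E = a z + v], the coefficient
    of [z] in [bracket D' E] is [D' a]; it vanishes for [D'] in [S] and for
    [D' = z] because these brackets stay in the span of [S], which misses [z].
    As evaluation at [a] is [R]-linear in the operator, it vanishes for every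
    [D] in the span of [z] and [S]. *)
Lemma bracket_add_central L S z D E :
    L `<=` [set D | derivation (K := K) D] ->
    S `<=` L -> L z -> ~ Rspan S z ->
    ad_stable L S -> central_mod L (Rspan S) z ->
    L D -> Rspan (z |` S) D -> L E -> Rspan (z |` S) E ->
  Rspan S (bracket D E).
Proof.
move=> derL SL Lz nSz stS cz LD TD LE /lin_span_setU1[a [v Sv defE]].
have sS := @lin_span_subspace R opR S.
have tailS D' : L D' -> Rspan S (a *: (bracket D' z : opR) + bracket D' v).
  by move=> LD'; apply: (proj2 sS); [apply: cz | apply: stS].
have brE D' : L D' -> bracket D' E =
    (D' a : R) *: (z : opR) + (a *: (bracket D' z : opR) + bracket D' v).
  by move=> LD'; rewrite defE bracketZD //; apply: derL.
have kill D' : L D' -> Rspan S (bracket D' E) -> D' a = 0.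
  move=> LD'; rewrite brE // => SbE; apply/eqP/negP => /negP D'a0.
  apply: nSz; rewrite -[z](@scale1r R opR) -(mulVf D'a0) -scalerA.
  apply: subspaceZ => //.
  have := subspaceB sS SbE (tailS _ LD').
  by rewrite addrK.
have : D a = 0.
  move: D TD {LD}.
  apply: (@lin_span_min R opR _ [set D | (D a : R) = 0]) => [|D' [->|SD']].
  - split=> // c u w /= ua wa.
    by rewrite -[LHS]/(c * u a + w a) ua wa mulr0 addr0.
  - (* [z] is central modulo the span and [E] lies in [L] *)
    apply: kill => //; rewrite bracket_anticomm; apply: (subspaceN sS).
    exact: cz.
  - apply: kill; first exact: SL.
    rewrite bracket_anticomm; apply: (subspaceN sS).
    by apply: stS => //; apply: sub_lin_span.
by rewrite brE // => ->; rewrite scale0r add0r; apply: tailS.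
Qed.

Lemma lower_central_sub L n :
  lie_subalgebra (K := K) L -> lower_central (K := K) L n `<=` L.
Proof.
move=> [L0 LZD Lbr]; elim: n => [|n IHn] //=.
apply: lin_span_min => [|_ [D LD [E LnE <-]]]; first by split.
by apply: Lbr => //; apply: IHn.
Qed.

Lemma derived_series_sub L n :
  lie_subalgebra (K := K) L -> derived_series (K := K) L n `<=` L.
Proof.
move=> [L0 LZD Lbr]; elim: n => [|n IHn] //=.
apply: lin_span_min => [|_ [D LD [E LE <-]]]; first by split.
by apply: Lbr; apply: IHn.
Qed.

(** Nilpotency enters here only: such an element is found in the last term of
    the lower central series that is not contained in [U]. *)
Lemma exists_central_mod L U :
    lie_subalgebra (K := K) L -> lie_nilpotent (K := K) L ->
    Rsubspace U -> ~ L `<=` U ->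
  exists z, [/\ L z, ~ U z & central_mod L U z].
Proof.
move=> Llie [n Ln0] sU nLU.
have : lower_central (K := K) L n `<=` U by rewrite Ln0 => _ ->; case: sU.
elim: n {Ln0} => [|n IHn] // LnU.
have [/IHn //|] := pselect (lower_central (K := K) L n `<=` U).
move=> /existsNP[z /not_implyP[Lnz nUz]].
exists z; split=> // [|D LD]; first exact: lower_central_sub Lnz.
by apply/LnU/sub_lin_span; exists D => //; exists z.
Qed.

(** Induction on the number [size e] of vectors that complete the span of [S]
    to a space containing [L]: a step trades one of them for a central
    element. *)
Lemma derived_series_sub_span L S (e : seq opR) :
    L `<=` [set D | derivation (K := K) D] ->
    lie_subalgebra (K := K) L -> lie_nilpotent (K := K) L ->
    S `<=` L -> ad_stable L S -> L `<=` Rspan (S `|` [set` e]) ->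
  derived_series (K := K) L (size e) `<=` Rspan S.
Proof.
move=> derL Llie Lnil.
move: {2}(size e) (erefl (size e)) => r sz_e.
elim: r S e sz_e => [|r IHr] S e sz_e SL stS Le.
  apply: subset_trans (derived_series_sub Llie) (subset_trans Le _).
  rewrite (size0nil sz_e); apply: (@lin_spanS R opR) => u [Su|//].
  exact: sub_lin_span.
have [LS|nLS] := pselect (L `<=` Rspan S).
  exact: subset_trans (derived_series_sub Llie) LS.
have sS := @lin_span_subspace R opR S.
have [z [Lz nSz cz]] := exists_central_mod Llie Lnil sS nLS.
have [e' sz_e' sub_e'] := lin_span_exchange (Le _ Lz) nSz.
have IH : derived_series (K := K) L (size e') `<=` Rspan (z |` S).
  apply: IHr; first by move: sz_e; rewrite sz_e' => -[].
  - by move=> u [->|/SL].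
  - exact: ad_stable_add_central.
  - exact: subset_trans Le sub_e'.
rewrite sz_e' /=; apply: Rsubspace_lin_span => // _ [D LD [E LE <-]].
by apply: (bracket_add_central (L := L) (z := z)) => //;
  [apply: derived_series_sub LD | apply: IH | apply: derived_series_sub LE | apply: IH].
Qed.

Lemma derived_series_rank_eq0 L k :
    L `<=` [set D | derivation (K := K) D] ->
    lie_subalgebra (K := K) L -> lie_nilpotent (K := K) L -> has_rank L k ->
  derived_series (K := K) L k = [set 0].
Proof.
move=> derL Llie Lnil [e [_ defRL]].
apply/seteqP; split=> [|_ ->]; last first.
  case: k {e defRL} => [|k]; first by case: Llie.
  by case: (lin_span_subspace
    [set lie_bracket D E | D in derived_series L k & E in derived_series L k]).
have sz_e : size (codom e) = k by rewrite size_codom card_ord.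
rewrite -[X in derived_series L X]sz_e.
rewrite -(@lin_span_set0 R opR).
apply: derived_series_sub_span => // [D LD E|D LD].
  rewrite /Rspan lin_span_set0 => ->.
  have [Dlin _] := derL _ LD.
  have D0 : D 0 = 0.
    by have := Dlin (-1) 0 0; rewrite scaler0 addr0 scaleN1r addNr.
  by apply/funext => x; rewrite -[LHS]/(D 0 - 0) D0 subr0.
have : Rspan L D by apply: sub_lin_span.
rewrite -defRL; move: D {LD}; apply: (@lin_spanS R opR) => _ [i _ <-].
by apply: sub_lin_span; right; apply: codom_f.
Qed.

End NilpotentDerivations.

Theorem corollary1 (K : fieldType) (A : idomAlgType K)
    (L : set ({fraction A} -> {fraction A})) (k : nat)
    (L_sub_W : L `<=` W K A)
    (L_lie : lie_subalgebra (K := K) L)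
    (L_nil : lie_nilpotent (K := K) L)
    (L_rank : has_rank L k) :
  exists2 s : nat, has_derived_length (K := K) L s & (s <= k)%N.
Proof.
have derL := subset_trans L_sub_W (@W_derivation K A).
have Lk0 := derived_series_rank_eq0 derL L_lie L_nil L_rank.
have ex : exists n, `[< derived_series (K := K) L n = [set 0] >].
  by exists k; apply/asboolP.
case: (ex_minnP ex) => s /asboolP Ls0 s_min.
exists s; last by apply/s_min/asboolP.
by split=> // t Lt0; apply/s_min/asboolP.
Qed.
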